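(* Let $M=(V,E,F)$ be a simplicial surface with boundary, and let $\ell,\tilde\ell:E\to\mathbb{R}_{>0}$ be discrete metrics on $M$ that are discretely conformally equivalent, with conformal scale factor $u:V\to\mathbb{R}$. Then $\ell$ and $\tilde\ell$ have the same length half cross ratios on all boundary edges if and only if $u$ is locally constant on the boundary, i.e. constant on the vertices of each connected component of the boundary of $M$.
   Context: A discrete metric on $M$ is an assignment of edge lengths $\ell:E\to\mathbb{R}_{>0}$ satisfying the triangle inequality on each face. Two discrete metrics $\ell,\tilde\ell$ are discretely conformally equivalent if there is a function $u:V\to\mathbb{R}$ (the conformal scale factor) with $\tilde\ell_{ij}=\exp\bigl(\tfrac12(u_i+u_j)\bigr)\,\ell_{ij}$ for every edge $ij\in E$. For a boundary edge $ij$, with $ijk$ the unique (oriented) face containing it, the length half cross ratio of $\ell$ at $ij$ is $\operatorname{lhcr}_{ij}=\ell_{jk}/\ell_{ki}$ (equivalently $\log\operatorname{lhcr}_{ij}=\log\ell_{jk}-\log\ell_{ki}$). *)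

(* Defs.v *)
(* MathComp / MathComp-Analysis. *)
From Stdlib Require Import Relation_Operators.
From HB Require Import structures.
From mathcomp Require Import all_boot all_order all_algebra finmap.
From mathcomp Require Import all_classical all_reals all_analysis.

Set Implicit Arguments.
Unset Strict Implicit.
Unset Printing Implicit Defensive.
Import Order.TTheory GRing.Theory Num.Theory.
Local Open Scope fset_scope.
Local Open Scope ring_scope.

(* The link of v, a graph on the neighbours of v with an edge xy for each face
   vxy, is the simple path with successive vertices c. *)
Definition link_is_path (V : choiceType) (E F : set {fset V}) (v : V)
    (c : seq V) : Prop :=
  [/\ uniq c, (2 <= size c)%N,
      forall w, E [fset v; w] <-> w \in c &
      forall x y, F [fset v; x; y] <->
        infix [:: x; y] c \/ infix [:: y; x] c].

(* Same, with c read cyclically. *)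
Definition link_is_cycle (V : choiceType) (E F : set {fset V}) (v : V)
    (c : seq V) : Prop :=
  [/\ uniq c, (3 <= size c)%N,
      forall w, E [fset v; w] <-> w \in c &
      forall x y, F [fset v; x; y] <->
        [/\ x \in c, y \in c & next c x = y \/ next c y = x]].

(* A surface whose vertices are all the elements of V; it need be neither
   finite, nor connected, nor orientable, and its boundary may be empty.
   The link condition makes every edge lie in one or two faces. *)
Record simplicial_surface (V : choiceType) := SimplicialSurface {
  edges : set {fset V};
  faces : set {fset V};
  card_edges : forall e, edges e -> #|` e| = 2%N;
  card_faces : forall f, faces f -> #|` f| = 3%N;
  edges_of_face : forall f e,
    faces f -> (e `<=` f)%fset -> #|` e| = 2%N -> edges e;
  links : forall v, exists c,
    link_is_path edges faces v c \/ link_is_cycle edges faces v c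
}.

(* A cyclic order on the vertices of each face.  Neighbouring faces are not
   required to be coherently oriented: an orientation of the surface is the
   special case where they are. *)
Record face_orientation (V : choiceType) (M : simplicial_surface V) :=
  FaceOrientation {
  oface : V -> V -> V -> Prop;
  oface_face : forall i j k, oface i j k -> faces M [fset i; j; k];
  oface_rot : forall i j k, oface i j k -> oface j k i;
  oface_swap : forall i j k,
    faces M [fset i; j; k] -> (oface i j k <-> ~ oface j i k)
}.

Definition boundary_edge (V : choiceType) (M : simplicial_surface V)
    (e : {fset V}) : Prop :=
  edges M e /\ exists! f, faces M f /\ (e `<=` f)%fset.

(* The boundary edge ij, directed as in the oriented face containing it. *)
Definition oriented_boundary_edge (V : choiceType) (M : simplicial_surface V)
    (o : face_orientation M) (i j : V) : Prop :=
  boundary_edge M [fset i; j] /\ exists k, oface o i j k.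

Definition boundary_vertex (V : choiceType) (M : simplicial_surface V)
    (v : V) : Prop :=
  exists2 e, boundary_edge M e & v \in e.

(* v and w are joined by a path of boundary edges. *)
Definition boundary_connected (V : choiceType) (M : simplicial_surface V)
    (v w : V) : Prop :=
  clos_refl_trans V (fun x y => boundary_edge M [fset x; y]) v w.

Definition locally_constant_on_boundary (R : realType) (V : choiceType)
    (M : simplicial_surface V) (u : V -> R) : Prop :=
  forall v w, boundary_vertex M v -> boundary_vertex M w ->
    boundary_connected M v w -> u v = u w.

(* Lengths are functions on all finite sets of vertices, of which only the
   values on edges matter.  Degenerate triangles are allowed. *)
Definition discrete_metric (R : realType) (V : choiceType)
    (M : simplicial_surface V) (l : {fset V} -> R) : Prop :=
  (forall e, edges M e -> 0 < l e) /\
  (forall i j k, faces M [fset i; j; k] ->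
     l [fset i; j] <= l [fset j; k] + l [fset k; i]).

Definition conformally_equivalent_by (R : realType) (V : choiceType)
    (M : simplicial_surface V) (l l' : {fset V} -> R) (u : V -> R) : Prop :=
  forall i j, edges M [fset i; j] ->
    l' [fset i; j] = expR (2^-1 * (u i + u j)) * l [fset i; j].

(* Meaningful for an oriented boundary edge ij, where k is the unique vertex
   such that ijk is an oriented face (i is a dummy default value). *)
Definition lhcr (R : realType) (V : choiceType) (M : simplicial_surface V)
    (o : face_orientation M) (l : {fset V} -> R) (i j : V) : R :=
  let k := xget i (oface o i j) in l [fset j; k] / l [fset k; i].

(* Main.v *)
Require Import Defs.
From Stdlib Require Import Relation_Operators.
From HB Require Import structures.
From mathcomp Require Import all_boot all_order all_algebra finmap.
From mathcomp Require Import all_classical all_reals all_analysis.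

(** Passing from [l] to [l'] multiplies the length of an edge by a factor
    [e^(u/2)] for each endpoint.  In the half cross ratio [l_jk / l_ki] the
    factor of the vertex [k], opposite to the boundary edge [ij], cancels, and
    what remains is multiplication by [e^((u_j - u_i)/2)]
    ([lhcr_conformal]).  As lengths are positive, the half cross ratio at [ij]
    is preserved exactly when [u_i = u_j] ([lhcr_conformal_eq]).

    It remains to see that every boundary edge contributes an equation: an
    orientation of the faces directs it in one way or the other
    ([boundary_edge_oriented]), and [u_i = u_j] does not depend on which.
    Equality of [u] at the ends of all boundary edges is then equality along
    paths of boundary edges. *)

Section ConformalChangeOfLhcr.
Import Order.TTheory GRing.Theory Num.Theory.
Local Open Scope fset_scope.
Local Open Scope ring_scope.

Lemma cardfs3_neq {V : choiceType} {i j k : V} :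
  #|` [fset i; j; k]| = 3%N -> [/\ i != j, j != k & k != i].
Proof.
have le2 (a b : V) : (#|` [fset a; b]| <= 2)%N by rewrite cardfs2 ltnS leq_b1.
move=> c3; split; apply/eqP => e; move: c3; rewrite e.
- by rewrite fsetUid => c3; have := le2 j k; rewrite c3.
- by rewrite -fsetUA fsetUid => c3; have := le2 i k; rewrite c3.
- by rewrite fsetUAC fsetUid => c3; have := le2 i j; rewrite c3.
Qed.

Lemma cardfs3_add1 {V : choiceType} {i j : V} {f : {fset V}} :
  #|` [fset i; j]| = 2%N -> #|` f| = 3%N -> [fset i; j] `<=` f ->
  exists k, f = [fset i; j; k].
Proof.
move=> c2 c3 sub; have := cardfsD f [fset i; j].
rewrite (fsetIidPr sub) c2 c3 => /eqP /cardfs1P[k ek].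
by exists k; rewrite -ek fsetUDl fsetDv fsetD0; apply/esym/fsetUidPr.
Qed.

Section Surface.
Context {V : choiceType} (M : simplicial_surface V).

Lemma edges_of_triangle {i j k : V} : faces M [fset i; j; k] ->
  edges M [fset j; k] /\ edges M [fset k; i].
Proof.
move=> fijk; have [_ jk ki] := cardfs3_neq (card_faces fijk).
split; apply: (edges_of_face fijk); rewrite ?cardfs2 ?jk ?ki //;
  by apply/fsubsetP => x; rewrite !inE => /orP[] ->; rewrite ?orbT.
Qed.

Lemma boundary_edge_vertices {i j : V} : boundary_edge M [fset i; j] ->
  boundary_vertex M i /\ boundary_vertex M j.
Proof. by move=> bij; split; exists [fset i; j]; rewrite ?inE ?eqxx ?orbT. Qed.

(** The direction is read off from the cyclic order of the face at the edge:
    with [k] its third vertex, either [ijk] or [jik] is positively ordered. *)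
Lemma boundary_edge_oriented (o : face_orientation M) {i j : V} :
  boundary_edge M [fset i; j] ->
  oriented_boundary_edge o i j \/ oriented_boundary_edge o j i.
Proof.
move=> bij; have [eij [f [[ff sub] _]]] := bij.
have [k fE] := cardfs3_add1 (card_edges eij) (card_faces ff) sub.
rewrite fE in ff; have [oij|noij] := pselect (oface o i j k).
  by left; split => //; exists k.
right; split; first by rewrite fsetUC.
exists k; apply/(oface_swap o); first by rewrite (fsetUC [fset j]).
exact: noij.
Qed.

Section Conformal.
Context {R : realType} (o : face_orientation M) (l l' : {fset V} -> R).
Context (u : V -> R) (hl : forall e, edges M e -> 0 < l e).
Context (hu : conformally_equivalent_by M l l' u).

(** The vertex opposite to [ij] depends on the orientation alone, so one [k]
    serves for both metrics that are compared. *)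
Lemma oriented_face_lhcr (i j : V) : oriented_boundary_edge o i j ->
  exists2 k, faces M [fset i; j; k] &
    forall m : {fset V} -> R, lhcr o m i j = m [fset j; k] / m [fset k; i].
Proof.
move=> [_ [k oijk]]; exists (xget i (oface o i j)); last by [].
by apply: (oface_face (f := o)); apply: (xgetPex i (P := oface o i j)); exists k.
Qed.

Lemma lhcr_gt0 (i j : V) : oriented_boundary_edge o i j -> 0 < lhcr o l i j.
Proof.
move=> /oriented_face_lhcr[k /edges_of_triangle[ejk eki] ->].
by apply: divr_gt0; apply: hl.
Qed.

(** Since [u_j + u_k - (u_k + u_i) = u_j - u_i], the factor of the opposite
    vertex cancels. *)
Lemma lhcr_conformal {i j : V} : oriented_boundary_edge o i j ->
  lhcr o l' i j = expR (2^-1 * (u j - u i)) * lhcr o l i j.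
Proof.
move=> /oriented_face_lhcr[k /edges_of_triangle[ejk eki] lE].
rewrite !lE (hu _ _ ejk) (hu _ _ eki) invfM mulrACA -expRN -expRD -mulrBr.
by rewrite opprD addrA addrK.
Qed.

(** The ratio is nonzero, hence can be cancelled; [expR] is injective. *)
Lemma lhcr_conformal_eq {i j : V} : oriented_boundary_edge o i j ->
  lhcr o l i j = lhcr o l' i j <-> u i = u j.
Proof.
move=> oij; rewrite (lhcr_conformal oij); split=> [h|->]; last first.
  by rewrite subrr mulr0 expR0 mul1r.
have l0 : lhcr o l i j != 0 by rewrite gt_eqF// lhcr_gt0.
have /expR_inj/eqP : expR (2^-1 * (u j - u i)) = expR 0.
  by apply: (mulIf l0); rewrite -h expR0 mul1r.
by rewrite mulf_eq0 invr_eq0 pnatr_eq0 /= subr_eq0 => /eqP.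
Qed.

End Conformal.

(** An equation propagates along paths by transitivity, so one step at a time is
    enough; conversely a boundary edge is a path of length one. *)
Lemma locally_constant_on_boundaryP {R : realType} (u : V -> R) :
  locally_constant_on_boundary M u <->
  forall i j, boundary_edge M [fset i; j] -> u i = u j.
Proof.
split=> [cst i j bij|step v w _ _].
  have [bi bj] := boundary_edge_vertices bij.
  by apply: cst => //; apply: rt_step.
by elim=> [x y /step|//|x y z _ -> _ ->].
Qed.

End Surface.
End ConformalChangeOfLhcr.

Theorem theorem4 (R : realType) (V : choiceType) (M : simplicial_surface V)
    (o : face_orientation M) (l l' : {fset V} -> R) (u : V -> R)
    (hl : discrete_metric M l) (hl' : discrete_metric M l')
    (hu : conformally_equivalent_by M l l' u) :
  (forall i j, oriented_boundary_edge o i j -> lhcr o l i j = lhcr o l' i j)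
  <-> locally_constant_on_boundary M u.
Proof.
have [l_gt0 _] := hl.
have lhcr_eq i j := @lhcr_conformal_eq _ M _ o l l' u l_gt0 hu i j.
rewrite locally_constant_on_boundaryP; split=> [same i j bij|cst i j oij].
  have [oij|oji] := boundary_edge_oriented _ o bij.
    by apply/(lhcr_eq _ _ oij)/same.
  by apply/esym/(lhcr_eq _ _ oji)/same.
by have [bij _] := oij; apply/(lhcr_eq _ _ oij)/cst.
Qed.
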